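(* Fix any $\lambda>0$ and $\mu>0$. For $(U,V)\in\mathbb{R}^{n\times r}\times\mathbb{R}^{m\times r}$ let $$F_\mu(U,V)=f(UV^{\mathbb{T}})+\frac{\mu}{2}\big(\|U\|_F^2+\|V\|_F^2\big),\qquad \Phi_{\lambda,\mu}(U,V)=F_\mu(U,V)+\lambda\big(\|U\|_{2,0}+\|V\|_{2,0}\big).$$ If $(\overline{U},\overline{V})$ is a local minimizer (respectively, strong local minimizer) of $F_\mu$, then it is a local minimizer (respectively, strong local minimizer) of $\Phi_{\lambda,\mu}$. Conversely, if $(\overline{U},\overline{V})$ is a nonzero local minimizer (respectively, nonzero strong local minimizer) of $\Phi_{\lambda,\mu}$, then $(\overline{U}_J,\overline{V}_J)$ with $J=J_{\overline{U}}$ is a local minimizer (respectively, strong local minimizer) of $F_\mu$ defined on $\mathbb{R}^{n\times|J|}\times\mathbb{R}^{m\times|J|}$ (i.e. of the function given by the same formula for $F_\mu$ on this space).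
   Context: Standing assumptions: $n\le m$, $r$ is a positive integer with $r\le n$; $f:\mathbb{R}^{n\times m}\to\mathbb{R}_+$ is smooth (continuously differentiable) and $\nabla f$ is Lipschitz continuous with modulus $L_f$. $\|Z\|_{2,0}$ is the number of nonzero columns of $Z$; $J_Z$ is the index set of nonzero columns of $Z$; $Z_J$ is the submatrix of $Z$ consisting of the columns indexed by $J$. A point $(\overline{U},\overline{V})$ is a strong local minimizer of a function $\Psi$ if there exist $\alpha>0$ and $\delta>0$ such that $\Psi(U,V)\ge\Psi(\overline{U},\overline{V})+\alpha\|(U,V)-(\overline{U},\overline{V})\|_F^2$ for all $(U,V)$ with $\|(U,V)-(\overline{U},\overline{V})\|_F\le\delta$. *)

(* Defs.v *)
From HB Require Import structures.
From mathcomp Require Import all_boot all_order all_algebra.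
From mathcomp Require Import all_classical all_reals all_analysis.

Set Implicit Arguments.
Unset Strict Implicit.
Unset Printing Implicit Defensive.

Import Order.TTheory GRing.Theory Num.Theory.
Import numFieldNormedType.Exports.

Local Open Scope ring_scope.

(* The library norm `|Z| on matrices is the max norm, so the Frobenius norm
   is defined here; both norms induce the same topology. *)
Definition normF (R : realType) (p q : nat) (Z : 'M[R]_(p, q)) : R :=
  Num.sqrt (\sum_i \sum_j Z i j ^+ 2).

Definition normF2 (R : realType) (n m r : nat)
    (U : 'M[R]_(n, r)) (V : 'M[R]_(m, r)) : R :=
  Num.sqrt (normF U ^+ 2 + normF V ^+ 2).

(* The matrix of partial derivatives: for f differentiable at X, this is the
   gradient with respect to the inner product <A, B> = \tr (A^T *m B). *)
Definition gradient (R : realType) (n m : nat) (f : 'M[R]_(n, m) -> R)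
    (X : 'M[R]_(n, m)) : 'M[R]_(n, m) :=
  \matrix_(i, j) 'D_(delta_mx i j) f X.

Definition smooth (R : realType) (n m : nat) (f : 'M[R]_(n, m) -> R) : Prop :=
  (forall X, differentiable f X) /\ continuous (gradient f).

Definition gradient_lipschitz (R : realType) (n m : nat)
    (f : 'M[R]_(n, m) -> R) (L : R) : Prop :=
  forall X Y, normF (gradient f X - gradient f Y) <= L * normF (X - Y).

Definition nzcols (R : realType) (p q : nat) (Z : 'M[R]_(p, q)) : {set 'I_q} :=
  [set j | col j Z != 0].

Definition norm20 (R : realType) (p q : nat) (Z : 'M[R]_(p, q)) : nat :=
  #|nzcols Z|.

(* The columns of Z indexed by J, in increasing order of their index. *)
Definition subcols (R : realType) (p q : nat) (J : {set 'I_q})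
    (Z : 'M[R]_(p, q)) : 'M[R]_(p, #|J|) :=
  colsub (fun k : 'I_#|J| => enum_val k) Z.

Definition local_minimizer (R : realType) (n m r : nat)
    (Psi : 'M[R]_(n, r) -> 'M[R]_(m, r) -> R)
    (Ubar : 'M[R]_(n, r)) (Vbar : 'M[R]_(m, r)) : Prop :=
  exists2 delta : R, 0 < delta &
    forall U V, normF2 (U - Ubar) (V - Vbar) <= delta ->
      Psi Ubar Vbar <= Psi U V.

Definition strong_local_minimizer (R : realType) (n m r : nat)
    (Psi : 'M[R]_(n, r) -> 'M[R]_(m, r) -> R)
    (Ubar : 'M[R]_(n, r)) (Vbar : 'M[R]_(m, r)) : Prop :=
  exists alpha delta : R, [/\ 0 < alpha, 0 < delta &
    forall U V, normF2 (U - Ubar) (V - Vbar) <= delta ->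
      Psi Ubar Vbar + alpha * normF2 (U - Ubar) (V - Vbar) ^+ 2 <= Psi U V].

Definition Fmu (R : realType) (n m : nat) (f : 'M[R]_(n, m) -> R) (mu : R)
    (r : nat) (U : 'M[R]_(n, r)) (V : 'M[R]_(m, r)) : R :=
  f (U *m V^T) + mu / 2 * (normF U ^+ 2 + normF V ^+ 2).

Definition Philm (R : realType) (n m : nat) (f : 'M[R]_(n, m) -> R)
    (lambda mu : R) (r : nat) (U : 'M[R]_(n, r)) (V : 'M[R]_(m, r)) : R :=
  Fmu f mu U V + lambda * (norm20 U + norm20 V)%:R.

(* Main.v *)
(** Lower semicontinuity of the column count makes every (strong) local
    minimizer of F_mu one of Phi_{lambda,mu}.  Conversely, if (U, V) is a local
    minimizer of Phi_{lambda,mu}, then U and V have the same nonzero columns: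
    were column j zero in U but not in V, shrinking it in V would keep U V^T,
    not increase the column counts, and strictly decrease the Frobenius norm.
    Padding with zero columns outside J is then a Frobenius isometry preserving
    U V^T, and it cannot increase the column counts beyond those of (U, V), so
    the minimality passes to the submatrices. *)
Require Import Defs.
From mathcomp Require Import all_boot all_order all_algebra.
From mathcomp Require Import all_classical all_reals all_analysis.
From mathcomp Require Import ring lra.

Import Order.TTheory GRing.Theory Num.Theory.
Import numFieldNormedType.Exports.

Local Open Scope ring_scope.

Section FrobeniusNorm.
Context {R : realType}.

Lemma normF_ge0 {p q} (Z : 'M[R]_(p, q)) : 0 <= normF Z.
Proof. exact: sqrtr_ge0. Qed.

Lemma sqr_normF {p q} (Z : 'M[R]_(p, q)) :
  normF Z ^+ 2 = \sum_i \sum_j Z i j ^+ 2.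
Proof.
by rewrite sqr_sqrtr// sumr_ge0// => i _; rewrite sumr_ge0// => j _; rewrite sqr_ge0.
Qed.

Lemma normF_trace {p q} (Z : 'M[R]_(p, q)) : normF Z = Num.sqrt (\tr (Z *m Z^T)).
Proof.
congr Num.sqrt; apply: eq_bigr => i _; rewrite mxE.
by apply: eq_bigr => j _; rewrite mxE expr2.
Qed.

(** Since [normF] depends on a matrix only through its Gram matrix of rows, [Q *m Q^T] cancels
    inside the trace. Used below with [Q] the zero padding [(colsel J)^T]. *)
Lemma normF_mul_isometry {p q s} (A : 'M[R]_(p, q)) (Q : 'M[R]_(q, s)) :
  Q *m Q^T = 1%:M -> normF (A *m Q) = normF A.
Proof.
by move=> QQ; rewrite !normF_trace trmx_mul -mulmxA (mulmxA Q) QQ mul1mx.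
Qed.

Lemma normFZ {p q} (a : R) (Z : 'M[R]_(p, q)) : normF (a *: Z) = `|a| * normF Z.
Proof.
rewrite -sqrtr_sqr /normF -sqrtrM ?sqr_ge0// mulr_sumr; congr Num.sqrt.
apply: eq_bigr => i _; rewrite mulr_sumr; apply: eq_bigr => j _.
by rewrite mxE exprMn.
Qed.

Lemma entry_le_normF {p q} (Z : 'M[R]_(p, q)) i j : `|Z i j| <= normF Z.
Proof.
rewrite -(ler_pXn2r (n := 2)) ?nnegrE ?normF_ge0// sqr_normF real_normK ?num_real//.
rewrite (bigD1 i)//= (bigD1 j)//= -addrA lerDl addr_ge0//.
  by rewrite sumr_ge0// => k _; rewrite sqr_ge0.
by rewrite sumr_ge0// => k _; rewrite sumr_ge0// => l _; rewrite sqr_ge0.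
Qed.

Lemma sqr_normF2 {n m r} (U : 'M[R]_(n, r)) (V : 'M[R]_(m, r)) :
  normF2 U V ^+ 2 = normF U ^+ 2 + normF V ^+ 2.
Proof. by rewrite sqr_sqrtr// addr_ge0// sqr_ge0. Qed.

Lemma normF2C {n m r} (U : 'M[R]_(n, r)) (V : 'M[R]_(m, r)) :
  normF2 U V = normF2 V U.
Proof. by rewrite /normF2 addrC. Qed.

Lemma normF_le_normF2 {n m r} (U : 'M[R]_(n, r)) (V : 'M[R]_(m, r)) :
  normF U <= normF2 U V.
Proof.
rewrite -(ler_pXn2r (n := 2)) ?nnegrE ?normF_ge0 ?sqrtr_ge0//.
by rewrite sqr_normF2 lerDl sqr_ge0.
Qed.

Lemma normF2_0l {n m r} (V : 'M[R]_(m, r)) : normF2 (0 : 'M[R]_(n, r)) V = normF V.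
Proof.
have -> : (0 : 'M[R]_(n, r)) = 0 *: 0 by rewrite scale0r.
by rewrite /normF2 normFZ normr0 mul0r expr0n add0r sqrtr_sqr ger0_norm ?normF_ge0.
Qed.

End FrobeniusNorm.

Section NonzeroColumns.
Context {R : realType}.

Lemma notin_nzcols {p q} {Z : 'M[R]_(p, q)} {j} :
  reflect (forall i, Z i j = 0) (j \notin nzcols Z).
Proof.
rewrite inE negbK; apply: (iffP eqP) => [Zj i|Zj].
  by have /colP/(_ i) := Zj; rewrite !mxE.
by apply/colP => i; rewrite !mxE.
Qed.

(** If a nonzero column of [Z] vanished in [W], some nonzero entry of [Z] would have moved by its
    full absolute value. Half the least such value is therefore a safe radius. *)
Lemma nzcols_near {p q} (Z : 'M[R]_(p, q)) :
  exists2 e : R, 0 < e &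
    forall W, normF (W - Z) <= e -> nzcols Z \subset nzcols W.
Proof.
(* The default value 1 keeps [a] positive when [Z] has no nonzero entry. *)
pose a := \big[Num.min/1]_(ij : 'I_p * 'I_q | Z ij.1 ij.2 != 0) `|Z ij.1 ij.2|.
have a0 : 0 < a.
  rewrite /a; elim/big_ind: _ => // [x y x0 y0|ij]; last by rewrite normr_gt0.
  by rewrite lt_min x0.
exists (a / 2); first by rewrite divr_gt0.
move=> W WZ; apply/fintype.subsetP => j; apply: contraTT => /notin_nzcols Wj.
apply/notin_nzcols => i; apply/eqP; apply: contraT => Zij.
have aZ : a <= `|Z i j|.
  exact: (@bigmin_le_cond _ _ _ _ (i, j)
    (fun ij => Z ij.1 ij.2 != 0) (fun ij => `|Z ij.1 ij.2|)).
have := entry_le_normF (W - Z) i j.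
rewrite !mxE Wj sub0r normrN => ?; lra.
Qed.

End NonzeroColumns.

Section ColumnSelection.
Context {R : realType} {r : nat} (J : {set 'I_r}).

(** As a matrix factor, column selection has a transpose that serves as the reverse operation: right
    multiplication by [colsel^T] puts columns back at the indices in [J] and zeros elsewhere. *)
Definition colsel : 'M[R]_(r, #|J|) := subcols J 1%:M.

Lemma subcolsE {p} (Z : 'M[R]_(p, r)) : subcols J Z = Z *m colsel.
Proof. by rewrite /colsel /subcols mulmx_colsub mulmx1. Qed.

(** The columns of [colsel] are distinct unit vectors because [enum_val] is injective. *)
Lemma colsel_tr_mul : colsel^T *m colsel = 1%:M.
Proof.
rewrite -subcolsE; apply/matrixP => k l; rewrite !mxE.
by rewrite (inj_eq enum_val_inj) eq_sym.
Qed.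

Lemma nzcols_pad {p} (A : 'M[R]_(p, #|J|)) : nzcols (A *m colsel^T) \subset J.
Proof.
apply/fintype.subsetP => j; apply: contraTT => jJ; apply/notin_nzcols => i.
rewrite mxE big1// => k _; rewrite !mxE.
case: eqP => [jk|]; last by rewrite mulr0.
by rewrite jk enum_valP in jJ.
Qed.

Lemma subcolsK {p} (Z : 'M[R]_(p, r)) :
  nzcols Z \subset J -> subcols J Z *m colsel^T = Z.
Proof.
move=> ZJ; apply/matrixP => i j; rewrite mxE.
have [jJ|jJ] := boolP (j \in J).
  (* Only the position of [j] in the enumeration of [J] contributes to the sum. *)
  rewrite (bigD1 (enum_rank_in jJ j))//= big1 => [|k kj].
    by rewrite !mxE enum_rankK_in// eqxx mulr1 addr0.
  rewrite !mxE; case: eqP => [jk|]; last by rewrite mulr0.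
  by case/eqP: kj; apply: enum_val_inj; rewrite enum_rankK_in.
have /notin_nzcols -> : j \notin nzcols Z by apply: contra jJ => /(fintype.subsetP ZJ).
rewrite big1// => k _; rewrite !mxE.
case: eqP => [jk|]; last by rewrite mulr0.
by rewrite jk enum_valP in jJ.
Qed.

End ColumnSelection.

(* Growth with alpha = 0 is plain local minimality, so both versions of the
   statement are instances of the same one. *)
Definition growth_minimizer {R : realType} {n m r : nat} (alpha : R)
    (Psi : 'M[R]_(n, r) -> 'M[R]_(m, r) -> R)
    (U0 : 'M[R]_(n, r)) (V0 : 'M[R]_(m, r)) : Prop :=
  exists2 delta : R, 0 < delta &
    forall U V, normF2 (U - U0) (V - V0) <= delta ->
      Psi U0 V0 + alpha * normF2 (U - U0) (V - V0) ^+ 2 <= Psi U V.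

Section Minimizers.
Context {R : realType} {n m : nat}.

Section Growth.
Context {r : nat} (Psi : 'M[R]_(n, r) -> 'M[R]_(m, r) -> R).
Context (U0 : 'M[R]_(n, r)) (V0 : 'M[R]_(m, r)).

Lemma local_minimizerP :
  local_minimizer Psi U0 V0 <-> growth_minimizer 0 Psi U0 V0.
Proof.
by split=> -[d d0 H]; exists d => // U V /H; rewrite mul0r addr0.
Qed.

Lemma strong_local_minimizerP :
  strong_local_minimizer Psi U0 V0 <->
  exists2 alpha, 0 < alpha & growth_minimizer alpha Psi U0 V0.
Proof.
split=> [[a [d [a0 d0 H]]]|[a a0 [d d0 H]]]; last by exists a, d.
by exists a => //; exists d.
Qed.

Lemma growth_local_minimizer alpha :
  0 <= alpha -> growth_minimizer alpha Psi U0 V0 -> local_minimizer Psi U0 V0.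
Proof.
move=> a0 [d d0 H]; exists d => // U V /H; apply: le_trans.
by rewrite lerDl mulr_ge0// sqr_ge0.
Qed.

End Growth.

Lemma growth_Fmu_Philm (f : 'M[R]_(n, m) -> R) (lambda mu alpha : R) r
    (U0 : 'M[R]_(n, r)) (V0 : 'M[R]_(m, r)) :
  0 <= lambda ->
  growth_minimizer alpha (@Fmu R n m f mu r) U0 V0 ->
  growth_minimizer alpha (@Philm R n m f lambda mu r) U0 V0.
Proof.
move=> l0 [d d0 H].
have [dU dU0 HU] := nzcols_near U0; have [dV dV0 HV] := nzcols_near V0.
exists (Num.min d (Num.min dU dV)); first by rewrite !lt_min d0 dU0.
move=> U V; rewrite !le_min => /and3P[hd hU hV].
rewrite /Philm addrAC lerD ?H// ler_wpM2l// ler_nat.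
apply: leq_add; apply: subset_leq_card.
  exact/HU/(le_trans (normF_le_normF2 _ _) hU).
by apply/HV/(le_trans _ hV); rewrite normF2C normF_le_normF2.
Qed.

Lemma Philm_minimizer_nzcols (f : 'M[R]_(n, m) -> R) (lambda mu : R) r
    (U0 : 'M[R]_(n, r)) (V0 : 'M[R]_(m, r)) :
  0 <= lambda -> 0 < mu ->
  local_minimizer (@Philm R n m f lambda mu r) U0 V0 ->
  nzcols V0 \subset nzcols U0.
Proof.
move=> l0 mu0 [d d0 H]; apply/fintype.subsetP => j; apply: contraTT => /notin_nzcols U0j.
apply/notin_nzcols => i; apply/eqP; apply: contraT => V0ij; exfalso.
(* [W] keeps column [j] of [V0] alone, so [V0 - e *: W] scales that column by [1 - e]. The choice of
   [e] gives both [0 < e <= 1] and [e * normF W <= d]. *)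
pose W : 'M[R]_(m, r) := \matrix_(k, l) (V0 k l *+ (l == j)).
pose e := d / (d + normF W).
have dW : 0 < d + normF W by rewrite ltr_pwDl ?normF_ge0.
have e0 : 0 < e by rewrite divr_gt0.
have e1 : e <= 1 by rewrite ler_pdivrMr// mul1r lerDl normF_ge0.
pose V := V0 - e *: W.
have VE k l : V k l = (if l == j then 1 - e else 1) * V0 k l.
  by rewrite !mxE; case: (l == j) => /=; rewrite ?mulr1n ?mulr0n; ring.
have near : normF2 (U0 - U0) (V - V0) <= d.
  have -> : V - V0 = (- e) *: W by rewrite /V addrC addKr scaleNr.
  rewrite subrr normF2_0l normFZ normrN gtr0_norm// /e mulrAC ler_pdivrMr//.
  by rewrite ler_pM2l// lerDr ltW.
(* Column [j] of [V] meets only the zero column [j] of [U0] in this product. *)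
have prodE : U0 *m V^T = U0 *m V0^T.
  apply/matrixP => k l; rewrite [LHS]mxE [RHS]mxE; apply: eq_bigr => h _.
  by rewrite [V^T _ _]mxE [V0^T _ _]mxE VE; case: eqP => [->|_]; rewrite ?U0j ?mul0r ?mul1r.
have card_le : (norm20 V <= norm20 V0)%N.
  apply: subset_leq_card; apply/fintype.subsetP => l; apply: contraTT => /notin_nzcols V0l.
  by apply/notin_nzcols => k; rewrite VE V0l mulr0.
have sq_le k l : V k l ^+ 2 <= V0 k l ^+ 2.
  rewrite VE exprMn ler_piMl ?sqr_ge0//; case: ifP => _; last by rewrite expr1n.
  by rewrite expr_le1//; lra.
(* No entry grows in square, and the strict gain comes from entry [(i, j)], which is nonzero in [V0]
   and scaled by [1 - e]. *)
have norm_lt : normF V ^+ 2 < normF V0 ^+ 2.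
  rewrite !sqr_normF (bigD1 i)//= [ltRHS](bigD1 i)//=.
  rewrite ltr_leD ?ler_sum// => [|k _]; last exact: ler_sum.
  rewrite (bigD1 j)//= [ltRHS](bigD1 j)//= ltr_leD ?ler_sum//.
  rewrite VE eqxx exprMn gtr_pMl ?expr_lt1//; first lra; first lra.
  by rewrite lt0r sqrf_eq0 V0ij sqr_ge0.
have := H _ _ near; apply/negP; rewrite -ltNge /Philm /Fmu prodE.
rewrite ltr_leD//; last by rewrite ler_wpM2l// ler_nat leq_add2l.
by rewrite ltrD2l ltr_pM2l ?divr_gt0// ltrD2l.
Qed.

End Minimizers.

Lemma Philm_minimizer_nzcols_eq {R : realType} {n m : nat}
    (f : 'M[R]_(n, m) -> R) (lambda mu : R) r
    (U0 : 'M[R]_(n, r)) (V0 : 'M[R]_(m, r)) :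
  0 <= lambda -> 0 < mu ->
  local_minimizer (@Philm R n m f lambda mu r) U0 V0 ->
  nzcols V0 = nzcols U0.
Proof.
move=> l0 mu0 H; apply/eqP; rewrite finset.eqEsubset.
rewrite (Philm_minimizer_nzcols _ _ _ _ _ _ l0 mu0 H) /=.
(* The other inclusion follows by exchanging the two factors, which replaces [f] by its composition
   with transposition. *)
apply: (Philm_minimizer_nzcols (fun X => f X^T) lambda mu) => //.
have PhiC U V : Philm (fun X => f X^T) lambda mu V U = Philm f lambda mu U V.
  by rewrite /Philm /Fmu trmx_mul trmxK [X in _ + mu / 2 * X]addrC addnC.
by case: H => d d0 H; exists d => // V U; rewrite normF2C !PhiC; exact: H.
Qed.

Lemma growth_Philm_Fmu {R : realType} {n m : nat}
    (f : 'M[R]_(n, m) -> R) (lambda mu alpha : R) r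
    (U0 : 'M[R]_(n, r)) (V0 : 'M[R]_(m, r)) :
  0 <= alpha -> 0 <= lambda -> 0 < mu ->
  growth_minimizer alpha (@Philm R n m f lambda mu r) U0 V0 ->
  growth_minimizer alpha (@Fmu R n m f mu #|nzcols U0|)
    (subcols (nzcols U0) U0) (subcols (nzcols U0) V0).
Proof.
move=> a0 l0 mu0 H.
have VU := Philm_minimizer_nzcols_eq _ _ _ _ _ _ l0 mu0
  (growth_local_minimizer _ _ _ _ a0 H).
case: H => d d0 H; exists d => //.
set J := nzcols U0 in VU *; pose P : 'M[R]_(r, #|J|) := colsel J.
have PP : P^T *m P^T^T = 1%:M by rewrite trmxK colsel_tr_mul.
have FmuP A B : Fmu f mu (A *m P^T) (B *m P^T) = Fmu f mu A B.
  rewrite /Fmu !normF_mul_isometry//.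
  by rewrite trmx_mul -mulmxA (mulmxA P^T) PP mul1mx.
have U0P : subcols J U0 *m P^T = U0 by rewrite subcolsK.
have V0P : subcols J V0 *m P^T = V0 by rewrite subcolsK// VU.
move=> A B; have := H (A *m P^T) (B *m P^T).
(* Only inside the two distances are [U0] and [V0] written as padded matrices. The differences are
   then padded too, so distances are unchanged and the same radius [d] serves. *)
rewrite -{1 3}U0P -{1 3}V0P -!mulmxBl /normF2 !normF_mul_isometry//.
move=> {}H /H {}H.
rewrite -(FmuP A) -(FmuP (subcols J U0)) U0P V0P.
move: H; rewrite /Philm.
have : lambda * (norm20 (A *m P^T) + norm20 (B *m P^T))%:R
    <= lambda * (norm20 U0 + norm20 V0)%:R.
  rewrite ler_wpM2l// ler_nat /norm20 VU.
  by rewrite leq_add// subset_leq_card// nzcols_pad.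
by move=> ? ?; lra.
Qed.

Theorem proposition2p7 (R : realType) (n m r : nat)
    (hnm : (n <= m)%N) (hr0 : (0 < r)%N) (hrn : (r <= n)%N)
    (f : 'M[R]_(n, m) -> R) (hf0 : forall X, 0 <= f X)
    (hfs : smooth f) (Lf : R) (hfL : gradient_lipschitz f Lf)
    (lambda mu : R) (hlambda : 0 < lambda) (hmu : 0 < mu)
    (Ubar : 'M[R]_(n, r)) (Vbar : 'M[R]_(m, r)) :
  [/\ local_minimizer (@Fmu R n m f mu r) Ubar Vbar ->
        local_minimizer (@Philm R n m f lambda mu r) Ubar Vbar,
      strong_local_minimizer (@Fmu R n m f mu r) Ubar Vbar ->
        strong_local_minimizer (@Philm R n m f lambda mu r) Ubar Vbar,
      (Ubar, Vbar) != 0 ->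
        local_minimizer (@Philm R n m f lambda mu r) Ubar Vbar ->
        local_minimizer (@Fmu R n m f mu #|nzcols Ubar|)
          (subcols (nzcols Ubar) Ubar) (subcols (nzcols Ubar) Vbar)
    & (Ubar, Vbar) != 0 ->
        strong_local_minimizer (@Philm R n m f lambda mu r) Ubar Vbar ->
        strong_local_minimizer (@Fmu R n m f mu #|nzcols Ubar|)
          (subcols (nzcols Ubar) Ubar) (subcols (nzcols Ubar) Vbar)].
Proof.
have l0 := ltW hlambda; split=> [||_|_].
- by move=> /local_minimizerP H; apply/local_minimizerP; exact: growth_Fmu_Philm.
- move=> /strong_local_minimizerP[a a0 H]; apply/strong_local_minimizerP.
  by exists a => //; exact: growth_Fmu_Philm.
- by move=> /local_minimizerP H; apply/local_minimizerP; exact: growth_Philm_Fmu H.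
- move=> /strong_local_minimizerP[a a0 H]; apply/strong_local_minimizerP.
  by exists a => //; exact: growth_Philm_Fmu (ltW a0) l0 hmu H.
Qed.
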